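(* Let $\beta_0,\dots,\beta_9$ be a basis of $\mathbb{R}^{1,9}$ with $\beta_i\cdot\beta_i=-2$ for all $i$, and, for $i\ne j$, $\beta_i\cdot\beta_j=1$ if $\{i,j\}$ is one of $\{1,2\},\{2,3\},\{3,4\},\{4,5\},\{5,6\},\{6,7\},\{7,8\},\{8,9\},\{0,4\}$ and $\beta_i\cdot\beta_j=0$ otherwise. Let $\nu$ be the vector with $\nu\cdot\beta_9=2$ and $\nu\cdot\beta_i=0$ for $i\neq 9$, and let $\Gamma=\langle R_{\beta_0},\dots,R_{\beta_9}\rangle$. Then the packing $\mathcal{P}_\beta=\Gamma(\nu)=\{\gamma(\nu):\gamma\in\Gamma\}$ is Apollonian.
   Context: Lorentz space. $\mathbb{R}^{1,N-1}$ is an $N$-dimensional real vector space with a symmetric bilinear form $\mathbf u\cdot\mathbf v$ of signature $(1,N-1)$ (one positive, $N-1$ negative). Here $N=10$, and the products $\beta_i\cdot\beta_j$ above define such a form (the Coxeter graph of the $\beta_i$ is the tree $T_{246}$; adding $\nu$ attaches a node to $\beta_9$ by a bold edge; one has $\nu\cdot\nu=-2$). Let $\mathcal{H}$ be one sheet of $\{\mathbf x:\mathbf x\cdot\mathbf x=1\}$, a model of $\mathbb{H}^{N-1}$; here it is the sheet containing a positive multiple of the vector $w_0$ defined by $w_0\cdot\beta_0=1$, $w_0\cdot\beta_i=0$ for $i\ne0$ (which has $w_0\cdot w_0>0$). Let $\mathcal{L}^+$ be the set of nonzero $\mathbf x$ with $\mathbf x\cdot\mathbf x=0$ and $\mathbf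 x\cdot D>0$ for $D\in\mathcal H$, and $\partial\mathcal{H}=\mathcal{L}^+/\mathbb{R}^+$, the boundary sphere of dimension $N-2$. For $\mathbf n$ with $\mathbf n\cdot\mathbf n<0$, $H_{\mathbf n}$ is the hyperplane $\mathbf n\cdot\mathbf x=0$, $H_{\mathbf n}^+=\{\mathbf x:\mathbf n\cdot\mathbf x>0\}$, and $R_{\mathbf n}(\mathbf x)=\mathbf x-2\frac{\mathbf n\cdot\mathbf x}{\mathbf n\cdot\mathbf n}\mathbf n$. The vector $\mathbf n$ represents the hyperplane $H_{\mathbf n}\cap\mathcal{H}$ of $\mathbb{H}^{N-1}$, and the $(N-3)$-sphere $H_{\mathbf n}\cap\partial\mathcal{H}$. $\mathcal{O}^+$ is the group of linear maps preserving the form and $\mathcal{H}$; for a lattice $\Lambda\subset\mathbb{R}^{1,N-1}$ (the $\mathbb Z$-span of a basis), $\mathcal{O}^+_\Lambda=\{T\in\mathcal{O}^+:T\Lambda=\Lambda\}$. Packings. A set $\mathcal{P}\subset\mathbb{R}^{1,N-1}$ is a packing if there is $k>0$ with $\mathbf n\cdot\mathbf n=-k$ for all $\mathbf n\in\mathcal{P}$ and $\mathbf n\cdot\mathbf n'\ge k$ for all distinct $\mathbf n,\mathbf n'\in\mathcal{P}$. It represents a packing of spheres in dimension $n=N-2$. It is a result of Maxwell that $\mathcal{P}_\beta$ is a packing. The cone of $\mathcal{P}$ is $\mathcal{K}_{\mathcal{P}}=\bigcap_{\mathbf n\in\mathcal{P}}H_{\mathbf n}^+$, and the residual set of $\mathcal{P}$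 is the intersection of $\mathcal{K}_{\mathcal P}$ with $\partial\mathcal{H}$. The packing is maximal if no sphere of positive radius can be placed in the residual set, i.e. the residual set has empty interior in $\partial\mathcal{H}$. A subgroup $G\le\mathcal{O}_\Lambda^+$ is geometrically finite if it has a convex fundamental domain in $\mathcal{H}$ with finitely many faces. A packing is crystallographic if there are a lattice $\Lambda$, a geometrically finite $G\le\mathcal{O}_\Lambda^+$ and a finite set $S\subset\Lambda$ such that, up to positive scaling of vectors, $\mathcal{P}=G(S)$. Two distinct $\mathbf n,\mathbf n'\in\mathcal{P}$ are tangent if $\mathbf n\cdot\mathbf n'=k$. A packing has the Apollonian property if every $\mathbf n\in\mathcal{P}$ is a member of a set of $N$ (here ten) pairwise tangent elements of $\mathcal{P}$. A packing is Apollonian if it is crystallographic, maximal, and has the Apollonian property. *)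

(* Defs.v *)
From HB Require Import structures.
From mathcomp Require Import all_boot all_order all_algebra.
From mathcomp Require Import all_classical all_reals all_analysis.

Set Implicit Arguments.
Unset Strict Implicit.
Unset Printing Implicit Defensive.

Import Order.TTheory GRing.Theory Num.Theory.
Import numFieldNormedType.Exports.

Local Open Scope classical_set_scope.
Local Open Scope ring_scope.

(* Vectors are rows and linear maps are square matrices acting on the right,  *)
(* x |-> x *m T.  A is the Gram matrix of the Lorentz form on 'rV[R]_n, and w *)
(* is a vector with w.w > 0 that singles out a sheet of {x | x.x = 1}.        *)
Section Lorentz.
Variables (R : realType) (n : nat) (A : 'M[R]_n) (w : 'rV[R]_n).
Implicit Types (x y v D : 'rV[R]_n) (T M : 'M[R]_n) (k : R).
Implicit Types (P S L F K : set 'rV[R]_n) (G : set 'M[R]_n).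

Definition ldot x y : R := (x *m A *m y^T) 0 0.

(* The rows of M form an orthogonal basis whose first vector has square 1 and *)
(* whose other vectors have square -1.                                        *)
Definition lorentzian : Prop :=
  A^T = A /\
  exists2 M, M \in unitmx &
    M *m A *m M^T = diag_mx (\row_(i < n) (if i == 0%N :> nat then 1 else -1)).

Definition sheet : set 'rV[R]_n := [set x | ldot x x = 1 /\ 0 < ldot x w].

Definition light_cone : set 'rV[R]_n :=
  [set x | [/\ x != 0, ldot x x = 0 & forall D, sheet D -> 0 < ldot x D]].

Definition ray x : set 'rV[R]_n := [set c *: x | c in [set c : R | 0 < c]].

(* The points of light_cone / R+ are the rays themselves. *)
Definition ideal_boundary : set (set 'rV[R]_n) := ray @` light_cone.

(* Quotient topology: U is open when the union of its rays is open in the     *)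
(* subspace light_cone.                                                       *)
Definition ideal_boundary_open (U : set (set 'rV[R]_n)) : Prop :=
  U `<=` ideal_boundary /\
  forall x, (\bigcup_(r in U) r) x ->
    within light_cone (nbhs x) (\bigcup_(r in U) r).

Definition reflection v x : 'rV[R]_n := x - (2 * ldot v x / ldot v v) *: v.

Definition reflection_mx v : 'M[R]_n := lin1_mx (reflection v).

Definition is_subgroup G : Prop :=
  [/\ G `<=` [set T | T \in unitmx], G 1%:M,
      forall T M, G T -> G M -> G (T *m M) & forall T, G T -> G (invmx T)].

Definition generated_group (X : set 'M[R]_n) : set 'M[R]_n := smallest is_subgroup X.

Definition group_orbit G S : set 'rV[R]_n := [set x *m T | x in S & T in G].

Definition Oplus : set 'M[R]_n :=
  [set T | (forall x y, ldot (x *m T) (y *m T) = ldot x y) /\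
           mulmxr T @` sheet = sheet].

Definition is_lattice L : Prop :=
  exists2 b : n.-tuple 'rV[R]_n, basis_of {:'rV[R]_n} b &
    L = [set x | exists c : 'I_n -> int, x = \sum_(i < n) tnth b i *~ c i].

Definition Oplus_lattice L : set 'M[R]_n :=
  [set T | Oplus T /\ mulmxr T @` L = L].

(* A convex subset of the hyperbolic space with finitely many faces, i.e. a   *)
(* finite intersection of closed half-spaces.                                 *)
Definition finite_sided_polyhedron F : Prop :=
  exists2 s : seq 'rV[R]_n, (forall v, v \in s -> ldot v v < 0) &
    F = [set x | sheet x /\ forall v, v \in s -> 0 <= ldot v x].

Definition sheet_interior F : set 'rV[R]_n :=
  [set x | sheet x /\ within sheet (nbhs x) F].

Definition fundamental_domain G F : Prop :=
  [/\ F `<=` sheet,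
      \bigcup_(T in G) (mulmxr T @` F) = sheet &
      forall T M, G T -> G M -> T != M ->
        sheet_interior (mulmxr T @` F) `&` sheet_interior (mulmxr M @` F)
        = set0].

Definition geometrically_finite G : Prop :=
  exists2 F, finite_sided_polyhedron F & fundamental_domain G F.

Definition is_packing k P : Prop :=
  (forall x, P x -> ldot x x = - k) /\
  (forall x y, P x -> P y -> x <> y -> k <= ldot x y).

Definition packing_cone P : set 'rV[R]_n := [set x | forall v, P v -> 0 < ldot v x].

Definition residual_set P : set (set 'rV[R]_n) :=
  [set r | ideal_boundary r /\ r `<=` packing_cone P].

Definition maximal_packing P : Prop :=
  forall U, ideal_boundary_open U -> U `<=` residual_set P -> U = set0.

(* Equality of the sets of rays is equality up to positive scaling. *)
Definition crystallographic P : Prop :=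
  exists L G S,
    [/\ is_lattice L, is_subgroup G /\ G `<=` Oplus_lattice L,
        geometrically_finite G, finite_set S /\ S `<=` L &
        ray @` P = ray @` group_orbit G S].

Definition tangent k x y : Prop := x <> y /\ ldot x y = k.

Definition apollonian_property k P : Prop :=
  forall x, P x ->
    exists f : 'I_n -> 'rV[R]_n,
      [/\ forall i, P (f i), exists i, f i = x &
          forall i j, i != j -> tangent k (f i) (f j)].

Definition apollonian P : Prop :=
  exists2 k, 0 < k &
    [/\ is_packing k P, crystallographic P, maximal_packing P
      & apollonian_property k P].

End Lorentz.

Definition T246_edges : seq (nat * nat) :=
  [:: (1, 2); (2, 3); (3, 4); (4, 5); (5, 6); (6, 7); (7, 8); (8, 9); (0, 4)]%N.

Definition T246_adj (i j : nat) : bool :=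
  ((i, j) \in T246_edges) || ((j, i) \in T246_edges).

(* Main.v *)
Require Import Defs.
From HB Require Import structures.
From mathcomp Require Import all_boot all_order all_algebra.
From mathcomp Require Import all_classical all_reals all_analysis.
From mathcomp Require Import ring lra zify.

(* Since the graph is a simply laced tree, every [gamma beta_i] is a           *)
(* nonnegative or a nonpositive combination of the [beta_j] (induction on      *)
(* reduced words).  As [nu] is dominant, [gamma nu - nu] is a nonnegative      *)
(* combination, and its [beta_9]-coordinate is at least 2 unless it vanishes;  *)
(* pairing with [nu] gives the packing inequality.  The images of [nu] under   *)
(* the initial products of [R_9, R_8, ..., R_1] are ten mutually tangent       *)
(* elements.  The chamber [beta_i . x >= 0] is a fundamental domain in the     *)
(* sheet: a translate of [x] is moved into it by minimising                    *)
(* [x . gamma rho] over the discrete orbit of a strictly dominant lattice      *)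
(* vector [rho].                                                               *)
(*   For maximality, let [f = nu + beta_9], the null root of the affine        *)
(* subdiagram E7 on [beta_0, ..., beta_7].  Isotropic lattice vectors [e] with *)
(* [e . f] odd are dense in the light cone up to scaling.  Such an [e] has a   *)
(* dominant translate [c]; if [e] were in the residual set then [c . nu > 0],  *)
(* which forces [c] onto the ray of the null root of the affine subdiagram E8, *)
(* and lattice vectors on that ray have only even products with the lattice.   *)

Import Order.TTheory GRing.Theory Num.Theory.
Import numFieldNormedType.Exports.
Local Open Scope classical_set_scope.
Local Open Scope ring_scope.

(** * Lorentzian forms *)

(** The engine is [cone_beta_wordmx]: the sign of a root can be read off reduced words of matrices.
    It gives [dominant_cone_sub], hence the uniqueness of dominant translates and, through
    [nu_orbit], the packing inequality. [sheet_dominant] supplies the existence of dominant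
    translates, so [chamber_fundamental] yields a finite-sided fundamental domain and the packing is
    crystallographic.

    Maximality plays two cusps of the chamber against each other. Near any forward light ray with
    positive product with [cusp], the E7 null root, [odd_isotropic_dense] finds a lattice ray whose
    generator has odd product with [cusp]. But by [isotropic_dominant_even], a dominant isotropic
    lattice vector on the positive side of [nu] has only even products with the lattice. Hence no
    open set of rays stays inside the residual set. *)

Section Form.
Context {R : realType} {n : nat}.
Variable A : 'M[R]_n.
Implicit Types x y z v : 'rV[R]_n.
Local Notation "x *d y" := (ldot A x y) (at level 40).

Lemma ldotDl x y z : (x + y) *d z = x *d z + y *d z.
Proof. by rewrite /ldot !mulmxDl mxE. Qed.

Lemma ldotDr x y z : x *d (y + z) = x *d y + x *d z.
Proof. by rewrite /ldot linearD mulmxDr mxE. Qed.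

Lemma ldotZl a x y : (a *: x) *d y = a * (x *d y).
Proof. by rewrite /ldot -!scalemxAl mxE. Qed.

Lemma ldotZr a x y : x *d (a *: y) = a * (x *d y).
Proof. by rewrite /ldot linearZ -scalemxAr mxE. Qed.

Lemma ldotNl x y : (- x) *d y = - (x *d y).
Proof. by rewrite -scaleN1r ldotZl mulN1r. Qed.

Lemma ldotNr x y : x *d (- y) = - (x *d y).
Proof. by rewrite -scaleN1r ldotZr mulN1r. Qed.

Lemma ldot0l y : 0 *d y = 0.
Proof. by rewrite -(scale0r 0) ldotZl mul0r. Qed.

Lemma ldot0r x : x *d 0 = 0.
Proof. by rewrite -(scale0r 0) ldotZr mul0r. Qed.

Lemma ldot_suml I (r : seq I) (P : pred I) (F : I -> 'rV[R]_n) y :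
  (\sum_(i <- r | P i) F i) *d y = \sum_(i <- r | P i) F i *d y.
Proof. exact: (big_morph (ldot A ^~ y) (fun x z => ldotDl x z y) (ldot0l y)). Qed.

Lemma ldot_sumr I (r : seq I) (P : pred I) (F : I -> 'rV[R]_n) x :
  x *d (\sum_(i <- r | P i) F i) = \sum_(i <- r | P i) x *d F i.
Proof. exact: (big_morph (ldot A x) (ldotDr x) (ldot0r x)). Qed.

Definition ldot_lin := (ldotDl, ldotDr, ldotZl, ldotZr, ldotNl, ldotNr).

Lemma reflection_is_linear v : linear (reflection A v).
Proof.
move=> a x y; rewrite /reflection !ldot_lin.
by apply/rowP => j; rewrite !mxE; ring.
Qed.
HB.instance Definition _ v :=
  GRing.isLinear.Build R 'rV[R]_n 'rV[R]_n *:%R (reflection A v)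
    (reflection_is_linear v).

Lemma mul_reflection_mx v x : x *m reflection_mx A v = reflection A v x.
Proof. exact: mul_rV_lin1. Qed.

Lemma cvg_ldot (T : Type) (F : set_system T) (FF : Filter F)
    (f g : T -> 'rV[R]_n) (x y : 'rV[R]_n) :
  f t @[t --> F] --> x -> g t @[t --> F] --> y -> f t *d g t @[t --> F] --> x *d y.
Proof.
move=> fx gy.
have ldotE z v : z *d v = \sum_j (\sum_k z 0 k * A k j) * v 0 j.
  by rewrite /ldot mxE; apply: eq_bigr => j _; rewrite !mxE.
have coordx (h : T -> 'rV[R]_n) z j : h t @[t --> F] --> z ->
    h t 0 j @[t --> F] --> z 0 j.
  by move=> hz; exact: (cvg_comp h (fun M : 'rV[R]_n => M 0 j) hz (@coord_continuous R 1 n 0 j z)).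
under eq_fun do rewrite ldotE.
rewrite ldotE; apply: cvg_big => [|j _]; first exact: add_continuous.
apply: cvgM; last exact: coordx.
apply: cvg_big => [|k _]; first exact: add_continuous.
by apply: cvgMr_tmp; exact: coordx.
Qed.

End Form.

(** * Causal structure of a form of signature (1, n) *)

Section Signature.
Context {R : realType} {n : nat}.
Variable A : 'M[R]_n.+1.
Hypothesis lorA : lorentzian A.
Implicit Types x y z v : 'rV[R]_n.+1.
Local Notation "x *d y" := (ldot A x y) (at level 40).

Lemma ldotC x y : x *d y = y *d x.
Proof.
case: lorA => symA _; rewrite /ldot -[in LHS](trmxK (x *m A *m y^T)) mxE.
by rewrite !trmx_mul trmxK symA mulmxA.
Qed.

Lemma ldot_nondegenerate x : (forall y, x *d y = 0) -> x = 0.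
Proof.
move=> x0; case: lorA => _ [M Mu MAM].
have DU : (M *m A *m M^T) \in unitmx.
  rewrite MAM unitmxE det_diag unitfE prodf_seq_neq0.
  by apply/allP => i _ /=; rewrite mxE; case: ifP; rewrite ?oppr_eq0 oner_eq0.
have AU : A \in unitmx by move: DU; rewrite !unitmx_mul => /andP[/andP[]].
have xA0 : x *m A = 0.
  apply/rowP => j; have := x0 (delta_mx 0 j).
  by rewrite /ldot trmx_delta -colE !mxE.
by rewrite -(mulmxK AU x) xA0 mul0mx.
Qed.

(* In the coordinates of an orthogonal basis, [z = a_0 y - b_0 x] has no *)
(* timelike component.                                                   *)
Lemma ldot_orthogonal_le0 x y : 0 < x *d x -> x *d y = 0 ->
  y *d y <= 0 /\ (y *d y = 0 -> y = 0).
Proof.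
move=> x_gt0 xy0; case: (lorA) => _ [M Mu MAM].
pose a z := z *m invmx M.
have formE z t : z *d t =
    a z 0 0 * a t 0 0 - \sum_(i < n) a z 0 (lift ord0 i) * a t 0 (lift ord0 i).
  rewrite -{1}(mulmxKV Mu z) -{1}(mulmxKV Mu t) -/(a z) -/(a t) /ldot trmx_mul.
  have -> : a z *m M *m A *m (M^T *m (a t)^T) = a z *m (M *m A *m M^T) *m (a t)^T.
    by rewrite !mulmxA.
  rewrite MAM mul_mx_diag mxE.
  rewrite big_ord_recl !mxE /= mulr1 -sumrN; congr (_ + _).
  by apply: eq_bigr => i _; rewrite !mxE /= mulrN1 mulNr.
have neg z : a z 0 0 = 0 -> z *d z <= 0.
  move=> z0; rewrite formE z0 mul0r sub0r oppr_le0.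
  by apply: sumr_ge0 => i _; rewrite -expr2 sqr_ge0.
have x0sq : x *d x <= a x 0 0 ^+ 2.
  rewrite formE -expr2 lerBlDr lerDl.
  by apply: sumr_ge0 => i _; rewrite -expr2 sqr_ge0.
have x0_gt0 : 0 < a x 0 0 ^+ 2 by exact: lt_le_trans x0sq.
pose p := a x 0 0; pose q := a y 0 0.
have zle : p ^+ 2 * (y *d y) + q ^+ 2 * (x *d x) <= 0.
  have /neg : a (p *: y + - q *: x) 0 0 = 0.
    have -> : a (p *: y + - q *: x) = p *: a y + - q *: a x.
      by rewrite /a mulmxDl !scalemxAl.
    rewrite [LHS]mxE [X in X + _]mxE [X in _ + X]mxE -/p -/q; ring.
  by rewrite !ldot_lin (ldotC y x) xy0; congr (_ <= 0); ring.
have q2 : 0 <= q ^+ 2 by exact: sqr_ge0.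
split; first by rewrite /p in zle; nra.
move=> y0; rewrite y0 in zle.
have q0 : q = 0.
  by apply/eqP; rewrite -sqrf_eq0 eq_le q2 andbT; rewrite /p in zle; nra.
have : y *d y = 0 by [].
rewrite formE -/q q0 mul0r sub0r => /eqP; rewrite oppr_eq0 psumr_eq0; last first.
  by move=> i _; rewrite -expr2 sqr_ge0.
move=> /allP ay0; suff ay : a y = 0 by rewrite -(mulmxKV Mu y) -/(a y) ay mul0mx.
apply/rowP => j; rewrite [RHS]mxE.
case: (unliftP ord0 j) => [i|] ->; last exact: q0.
by have := ay0 i (mem_index_enum _); rewrite /= mulf_eq0 orbb => /eqP.
Qed.

(** Some [t *: x + y] with [t <= 0] is orthogonal to the timelike [w]. If [x *d y <= 0], its square
    is a sum of nonnegative terms, so it vanishes; this forces [t = 0] and then [y = 0]. *)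
Lemma ldot_causal_gt0 w x y : 0 < x *d x -> 0 <= y *d y -> y != 0 ->
  0 < w *d w -> 0 < x *d w -> 0 <= y *d w -> 0 < x *d y.
Proof.
move=> xx yy y0 ww xw yw; rewrite ltNge; apply/negP => xy.
pose t := - (y *d w) / (x *d w).
have t_le0 : t <= 0 by rewrite /t mulNr oppr_le0 divr_ge0 // ltW.
have wz : w *d (t *: x + y) = 0.
  by rewrite !ldot_lin (ldotC w x) (ldotC w y) /t divfK ?gt_eqF // addNr.
have [zz zz0] := ldot_orthogonal_le0 _ _ ww wz.
have zzE : (t *: x + y) *d (t *: x + y) = t ^+ 2 * (x *d x) + 2 * t * (x *d y) + y *d y.
  by rewrite !ldot_lin (ldotC y x); ring.
have t2 : 0 <= t ^+ 2 * (x *d x) by rewrite mulr_ge0 ?sqr_ge0 // ltW.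
have txy : 0 <= t * (x *d y) by exact: mulr_le0.
have : t ^+ 2 * (x *d x) = 0 by nra.
move=> /eqP; rewrite mulf_eq0 (gt_eqF xx) orbF sqrf_eq0 => /eqP t0.
move: zz0; rewrite t0 scale0r add0r => zz0.
by move/eqP: y0; apply; apply: zz0; rewrite zzE t0 in zz; nra.
Qed.

(** Reduces positivity against the whole sheet to one test against [w], which is on the sheet after
    scaling. *)
Lemma light_coneP w x : 0 < w *d w ->
  light_cone A w x <-> [/\ x != 0, x *d x = 0 & 0 < x *d w].
Proof.
move=> ww; split=> [[x0 xx xD]|[x0 xx xw]].
  split=> //; pose c := (Num.sqrt (w *d w))^-1.
  have c_gt0 : 0 < c by rewrite invr_gt0 sqrtr_gt0.
  have : 0 < x *d (c *: w).
    apply: xD; split; rewrite !ldot_lin.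
      by rewrite mulrA /c -expr2 exprVn sqr_sqrtr ?ltW // mulVf // gt_eqF.
    by rewrite mulr_gt0.
  by rewrite ldotZr pmulr_rgt0.
split=> // D [DD Dw]; rewrite ldotC.
by apply: (ldot_causal_gt0 w); rewrite ?DD ?xx // ltW.
Qed.

End Signature.

(** * The Coxeter group of the tree T246 *)

Definition gram (i j : nat) : int :=
  if i == j then -2 else if T246_adj i j then 1 else 0.

(* Twice the inverse of the Gram matrix of the [beta_i]. *)
Definition wt_table : seq (seq int) :=
  [:: [:: 5; 3; 6;  9; 12; 10; 8; 6; 4; 2];
      [:: 3; 0; 2;  4;  6;  5; 4; 3; 2; 1];
      [:: 6; 2; 4;  8; 12; 10; 8; 6; 4; 2];
      [:: 9; 4; 8; 12; 18; 15; 12; 9; 6; 3];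
      [:: 12; 6; 12; 18; 24; 20; 16; 12; 8; 4];
      [:: 10; 5; 10; 15; 20; 15; 12; 9; 6; 3];
      [:: 8; 4; 8; 12; 16; 12; 8; 6; 4; 2];
      [:: 6; 3; 6;  9; 12;  9; 6; 3; 2; 1];
      [:: 4; 2; 4;  6;  8;  6; 4; 2; 0; 0];
      [:: 2; 1; 2;  3;  4;  3; 2; 1; 0; -1]].

Definition wt_coef (i j : nat) : int := nth 0 (nth [::] wt_table i) j.

(** Turns a finite check over ordinals into a closed boolean on [nat], which [vm_compute] can
    decide. *)
Lemma all_ord2 (n : nat) (P : nat -> nat -> bool) :
  all (fun i => all (P i) (iota 0 n)) (iota 0 n) -> forall i j : 'I_n, P i j.
Proof.
have mem (i : 'I_n) : (i : nat) \in iota 0 n by rewrite mem_iota /= ltn_ord.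
by move=> /allP allPi i j; exact: (allP (allPi i (mem i))).
Qed.

Lemma wt_coef_gram (i j : 'I_10) :
  \sum_(k < 10) wt_coef i k * gram k j = (if i == j then 2 else 0).
Proof.
rewrite -(big_mkord xpredT (fun k => wt_coef i k * gram k j)) unlock -val_eqE.
apply/eqP; move: i j; apply: (all_ord2 10 (fun i j =>
  foldr (fun k s => wt_coef i k * gram k j + s) 0 (iota 0 10)
    == (if i == j then 2 else 0))).
by vm_compute.
Qed.

Lemma wt_coefC (i j : 'I_10) : wt_coef i j = wt_coef j i.
Proof.
apply/eqP; move: i j; apply: (all_ord2 10 (fun i j => wt_coef i j == wt_coef j i)).
by vm_compute.
Qed.

(** The only negative entry of the table is at [(9, 9)], half the square of [nu]. *)
Lemma wt_coef_ge0 (i j : 'I_10) : i != 9%N :> nat -> 0 <= wt_coef i j.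
Proof.
move=> i9; apply: (implyP _ i9); move: i j {i9}.
apply: (all_ord2 10 (fun i j => (i != 9%N) ==> (0 <= wt_coef i j))).
by vm_compute.
Qed.

(** The zeros on the diagonal, at 1 and 8, come from the null roots of the affine subdiagrams E8 and
    E7. *)
Lemma wt_coef_diag_gt0 (i : 'I_10) : (i : nat) \notin [:: 1; 8; 9]%N -> 0 < wt_coef i i.
Proof.
apply/implyP.
apply: (all_ord2 10 (fun i _ => (i \notin [:: 1; 8; 9]%N) ==> (0 < wt_coef i i)) _ i i).
by vm_compute.
Qed.

Lemma mulmx_ext {R : pzRingType} {m n : nat} (M N : 'M[R]_(m, n)) :
  (forall x : 'rV[R]_m, x *m M = x *m N) -> M = N.
Proof. by move=> MN; apply/row_matrixP => i; rewrite !rowE. Qed.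

Section T246.
Context {R : realType} {A : 'M[R]_10}.
Context {beta : 10.-tuple 'rV[R]_10}.
Hypothesis lorA : lorentzian A.
Hypothesis beta_basis : basis_of {:'rV[R]_10} beta.
Hypothesis beta_diag : forall i : 'I_10,
  ldot A (tnth beta i) (tnth beta i) = -2.
Hypothesis beta_offdiag : forall i j : 'I_10, i != j ->
  ldot A (tnth beta i) (tnth beta j) = if T246_adj i j then 1 else 0.
Implicit Types (x y v : 'rV[R]_10) (i j k : 'I_10) (s : seq 'I_10).
Local Notation "x *d y" := (ldot A x y) (at level 40).
Local Notation b := (tnth beta).
Local Notation dotC := (ldotC A lorA).

Lemma beta_gram i j : b i *d b j = (gram i j)%:~R.
Proof.
rewrite /gram val_eqE; have [->|ij] := eqVneq i j; first by rewrite beta_diag.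
by rewrite beta_offdiag //; case: ifP.
Qed.

Lemma beta_span x : exists c : 'I_10 -> R, x = \sum_i c i *: b i.
Proof.
exists (fun i => coord beta i x); rewrite [LHS](coord_basis beta_basis (memvf _)).
by apply: eq_bigr => i _; rewrite -tnth_nth.
Qed.

Lemma beta_separates x y : (forall i, x *d b i = y *d b i) -> x = y.
Proof.
move=> xy; apply/subr0_eq/(ldot_nondegenerate _ lorA) => z.
have [c ->] := beta_span z; rewrite ldot_sumr big1 // => i _.
by rewrite !ldot_lin xy subrr mulr0.
Qed.

(* Twice the fundamental weights. *)
Definition wt i : 'rV[R]_10 := \sum_(k < 10) (wt_coef i k)%:~R *: b k.

Lemma wt_beta i j : wt i *d b j = if i == j then 2 else 0.
Proof.
rewrite ldot_suml; under eq_bigr do rewrite ldotZl beta_gram -intrM.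
by rewrite -[LHS](raddf_sum (intmul 1)) wt_coef_gram; case: ifP.
Qed.

Lemma sum_beta_wt (c : 'I_10 -> R) i : (\sum_k c k *: b k) *d wt i = 2 * c i.
Proof.
rewrite ldot_suml (bigD1 i) //= big1 ?addr0.
  by rewrite ldotZl dotC wt_beta eqxx mulrC.
by move=> k ki; rewrite ldotZl dotC wt_beta eq_sym (negPf ki) mulr0.
Qed.

Lemma wt_wt i j : wt i *d wt j = 2 * (wt_coef i j)%:~R.
Proof. exact: sum_beta_wt. Qed.

Lemma beta_expand x : x = \sum_i (x *d wt i / 2) *: b i.
Proof.
have [c xE] := beta_span x; rewrite [LHS]xE; apply: eq_bigr => i _.
by rewrite xE sum_beta_wt mulrC mulKf.
Qed.

Lemma wt_expand x : x = \sum_i (x *d b i / 2) *: wt i.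
Proof.
apply: beta_separates => j; rewrite ldot_suml (bigD1 j) //= big1 ?addr0.
  by rewrite ldotZl wt_beta eqxx divfK.
by move=> k kj; rewrite ldotZl wt_beta (negPf kj) mulr0.
Qed.

Lemma wt_separates x y : (forall i, x *d wt i = y *d wt i) -> x = y.
Proof.
move=> xy; rewrite (beta_expand x) (beta_expand y).
by apply: eq_bigr => i _; rewrite xy.
Qed.

Definition rmx i := reflection_mx A (b i).

Lemma mul_rmx x i : x *m rmx i = x + (x *d b i) *: b i.
Proof.
rewrite mul_reflection_mx /reflection beta_diag dotC -scaleNr.
by congr (_ + _ *: _); field.
Qed.

Lemma rmxK i : rmx i *m rmx i = 1%:M.
Proof.
apply: mulmx_ext => x; rewrite mulmx1 mulmxA !mul_rmx !ldot_lin beta_diag.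
by apply/rowP => j; rewrite !mxE; ring.
Qed.

Lemma ldot_rmx x y i : (x *m rmx i) *d (y *m rmx i) = x *d y.
Proof. by rewrite !mul_rmx !ldot_lin beta_diag (dotC (b i) y); ring. Qed.

Lemma rmx_commute i j : b i *d b j = 0 -> rmx i *m rmx j = rmx j *m rmx i.
Proof.
move=> ij; apply: mulmx_ext => x; rewrite !mulmxA !mul_rmx !ldot_lin.
rewrite ij (dotC (b j)) ij.
by apply/rowP => k; rewrite !mxE; ring.
Qed.

Lemma rmx_braid i j : b i *d b j = 1 ->
  rmx i *m rmx j *m rmx i = rmx j *m rmx i *m rmx j.
Proof.
move=> ij; apply: mulmx_ext => x; rewrite !mulmxA !mul_rmx !ldot_lin.
rewrite !beta_diag ij (dotC (b j)) ij.
by apply/rowP => k; rewrite !mxE; ring.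
Qed.

(** * Reduced words and positive roots *)

Definition wordmx s : 'M[R]_10 := foldr (fun i M => rmx i *m M) 1%:M s.

Lemma wordmx_cat s t : wordmx (s ++ t) = wordmx s *m wordmx t.
Proof. by elim: s => [|i s IHs] /=; rewrite ?mul1mx // IHs mulmxA. Qed.

Lemma wordmx_rev s : wordmx (rev s) *m wordmx s = 1%:M.
Proof.
elim: s => [|i s IHs] /=; first by rewrite mulmx1.
rewrite rev_cons -cats1 wordmx_cat /= mulmx1 -mulmxA (mulmxA (rmx i)) rmxK.
by rewrite mul1mx.
Qed.

Lemma ldot_wordmx s x y : (x *m wordmx s) *d (y *m wordmx s) = x *d y.
Proof.
elim: s x y => [|i s IHs] x y /=; first by rewrite !mulmx1.
by rewrite !mulmxA IHs ldot_rmx.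
Qed.

(** Length is taken among words with the same matrix, so the group is handled through its linear
    action and not through a presentation. *)
Definition reduced s := forall s', wordmx s' = wordmx s -> (size s <= size s')%N.

Lemma reduced_exists s : exists2 s', reduced s' & wordmx s' = wordmx s.
Proof.
elim: {s}(size s) {-2}s (leqnn (size s)) => [|n IHn] s sn.
  by exists s => // s' _; move: sn; case: s.
have [|s_nred] := pselect (reduced s); first by exists s.
have [s' [s's lt]] : exists s', wordmx s' = wordmx s /\ (size s' < size s)%N.
  apply: contrapT => no; apply: s_nred => s' s's; rewrite leqNgt; apply/negP => lt.
  by apply: no; exists s'.
rewrite -s's; apply: IHn.
by rewrite -ltnS; exact: leq_trans sn.
Qed.

Lemma reduced_cons i s : reduced (i :: s) -> reduced s.
Proof. by move=> red s' s's; apply: (red (i :: s')); rewrite /= s's. Qed.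

(** By [sum_beta_wt], [x *d wt i] is twice the coordinate of [x] along [b i]: these are the
    nonnegative combinations of simple roots. *)
Definition cone x := forall i, 0 <= x *d wt i.

Definition dominant x := forall i, 0 <= x *d b i.

Lemma coneD x y : cone x -> cone y -> cone (x + y).
Proof. by move=> cx cy i; rewrite ldotDl addr_ge0. Qed.

Lemma coneZ a x : 0 <= a -> cone x -> cone (a *: x).
Proof. by move=> a0 cx i; rewrite ldotZl mulr_ge0. Qed.

Lemma cone_anti x : cone x -> cone (- x) -> x = 0.
Proof.
move=> cx cNx; apply: wt_separates => i; rewrite ldot0l; apply/eqP.
by rewrite eq_le cx andbT -oppr_ge0 -ldotNl.
Qed.

Lemma cone_beta i : cone (b i).
Proof. by move=> j; rewrite dotC wt_beta; case: ifP. Qed.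

(* In a simply laced Coxeter group: multiplying by a simple reflection that *)
(* does not shorten a word sends its simple root to a positive root.        *)
Lemma cone_beta_wordmx s i : reduced s ->
  (forall s', wordmx s' = rmx i *m wordmx s -> (size s <= size s')%N) ->
  cone (b i *m wordmx s).
Proof.
elim: {s}(size s) {-2}s (leqnn (size s)) i => [|n IHn] s sn i red lenP.
  by move: sn; case: s {red lenP} => //= _; rewrite mulmx1; exact: cone_beta.
case: s sn red lenP => [|j s1] sn red lenP.
  by rewrite mulmx1; exact: cone_beta.
have red1 := reduced_cons _ _ red.
have [ij|ij] := eqVneq i j.
  have := lenP s1; rewrite ij /= mulmxA rmxK mul1mx => /(_ erefl).
  by rewrite ltnn.
have cj : cone (b j *m wordmx s1).
  by apply: IHn => // s' s's; apply: ltnW; exact: red.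
rewrite /= mulmxA mul_rmx.
have [adj|nadj] := boolP (T246_adj i j); last first.
  have ij0 : b i *d b j = 0 by rewrite beta_offdiag // (negPf nadj).
  rewrite ij0 scale0r addr0; apply: IHn => // s' s's.
  have := lenP (j :: s'); rewrite /= s's !mulmxA (rmx_commute _ _ ij0); exact.
have ij1 : b i *d b j = 1 by rewrite beta_offdiag // adj.
rewrite ij1 scale1r mulmxDl.
(* The root is now the sum of the images of [b i] and [b j] under [s1]. Either both are positive by
   induction, or [s1] can be rewritten to start with [i]; the sum then collapses to the image of
   [b j] under the shorter [s2], and the braid relation transfers the length hypothesis. *)
have [len1|] := pselect (forall s', wordmx s' = rmx i *m wordmx s1 -> (size s1 <= size s')%N).
  by apply: coneD => //; exact: IHn.
move=> /existsNP[s2 /not_implyP[s2E /negP]]; rewrite -ltnNge => lt21.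
have s1E : wordmx s1 = rmx i *m wordmx s2 by rewrite s2E mulmxA rmxK mul1mx.
have size1 : size s1 = (size s2).+1.
  apply/eqP; rewrite eqn_leq lt21 andbT.
  by apply: (red1 (i :: s2)); rewrite /= s1E.
have red2 : reduced s2.
  move=> s' s's; rewrite -ltnS -size1.
  by apply: (red1 (i :: s')); rewrite /= s's s1E.
have -> : b i *m wordmx s1 + b j *m wordmx s1 = b j *m wordmx s2.
  rewrite s1E !mulmxA !mul_rmx beta_diag (dotC (b j)) ij1 -mulmxDl.
  by congr (_ *m _); apply/rowP => k; rewrite !mxE; ring.
apply: IHn => // [|s' s's].
  by move: sn; rewrite /= size1; lia.
have := lenP (j :: i :: s'); rewrite /= s's s1E !mulmxA (rmx_braid _ _ ij1) => /(_ erefl).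
by rewrite size1.
Qed.

Lemma cone_beta_reduced i s : reduced (i :: s) -> cone (b i *m wordmx s).
Proof.
move=> red; apply: cone_beta_wordmx; first exact: reduced_cons red.
by move=> s' s's; apply: ltnW; exact: red.
Qed.

(** Each letter [i] in front of [s] adds [x *d b i >= 0] times the positive root
    [b i *m wordmx s]. *)
Lemma dominant_cone_sub s x : reduced s -> dominant x -> cone (x *m wordmx s - x).
Proof.
move=> red dx; elim: s red => [|i s IHs] red /=.
  by rewrite mulmx1 subrr => j; rewrite ldot0l.
rewrite mulmxA mul_rmx mulmxDl -scalemxAl addrAC.
apply: coneD; first by apply: IHs; exact: reduced_cons red.
by apply: coneZ => //; exact: cone_beta_reduced.
Qed.

(** Applied to a word and to its inverse, [dominant_cone_sub] puts the difference and its opposite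
    in the pointed cone. *)
Lemma dominant_unique s x : dominant x -> dominant (x *m wordmx s) -> x *m wordmx s = x.
Proof.
move=> dx dxs; have [t redt tE] := reduced_exists s.
have [r redr rE] := reduced_exists (rev s).
apply/subr0_eq/cone_anti; first by rewrite -tE; exact: dominant_cone_sub.
have := dominant_cone_sub _ _ redr dxs.
by rewrite rE -{1}(revK s) -mulmxA wordmx_rev mulmx1 opprB.
Qed.

(** * The packing and its tangent simplices *)

Local Notation node k := (@Ordinal 10 k isT).

Variables w0 nu : 'rV[R]_10.
Hypothesis w0_beta : forall i : 'I_10,
  ldot A w0 (tnth beta i) = if i == 0%N :> nat then 1 else 0.
Hypothesis nu_beta : forall i : 'I_10,
  ldot A nu (tnth beta i) = if i == 9%N :> nat then 2 else 0.

Lemma nuE : nu = wt (node 9).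
Proof. by apply: beta_separates => i; rewrite nu_beta wt_beta -val_eqE eq_sym. Qed.

Lemma w0E : w0 = 2^-1 *: wt (node 0).
Proof.
apply: beta_separates => i; rewrite w0_beta ldotZl wt_beta -val_eqE eq_sym.
by case: ifP => _; [rewrite mulVf|rewrite mulr0].
Qed.

Lemma nu_nu : nu *d nu = -2.
Proof. by rewrite nuE wt_wt mulrN1. Qed.

Lemma w0_w0_gt0 : 0 < w0 *d w0.
Proof. by rewrite w0E !ldot_lin wt_wt !pmulr_rgt0 ?invr_gt0 // ltr0z. Qed.

(** Only the letter 9 moves [nu], adding twice the root [b 9]. The product with [nu] then grows by
    twice the product of [nu] with a positive root: from -2 to 2 if the rest of the word fixes [nu],
    and by a nonnegative amount otherwise. *)
Lemma nu_orbit s : nu *m wordmx s = nu \/ 2 <= nu *d (nu *m wordmx s).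
Proof.
have [t redt <-] := reduced_exists s.
elim: t redt => [|i t IHt] red /=; first by left; rewrite mulmx1.
rewrite mulmxA mul_rmx nu_beta; case: ifP => [i9|_]; last first.
  by rewrite scale0r addr0; apply: IHt; exact: reduced_cons red.
have {i9} i9 : i = (node 9) by apply/val_inj/eqP.
right; rewrite mulmxDl -scalemxAl ldotDr ldotZr.
case: (IHt (reduced_cons _ _ red)) => [fix_nu|nu_le].
  rewrite -{3}fix_nu ldot_wordmx fix_nu nu_nu nu_beta i9 /=; lra.
have := cone_beta_reduced _ _ red (node 9); rewrite -nuE dotC; lra.
Qed.

(** * The reflection group and the orbit of [nu] *)

Definition Gamma := generated_group [set reflection_mx A (tnth beta i) | i in [set: 'I_10]].

Lemma invmx_wordmx s : invmx (wordmx s) = wordmx (rev s).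
Proof.
have /mulmx1_unit[_ u] := wordmx_rev s.
by rewrite -[LHS]mul1mx -(wordmx_rev s) mulmxK.
Qed.

Lemma GammaP T : Gamma T <-> exists s, T = wordmx s.
Proof.
split=> [|[s ->]].
  have words_subgroup : is_subgroup [set T | exists s, T = wordmx s].
    split=> [_ [s ->]|||].
    - by have /mulmx1_unit[] := wordmx_rev s.
    - by exists [::].
    - by move=> _ _ [s ->] [t ->]; exists (s ++ t); rewrite wordmx_cat.
    - by move=> _ [s ->]; exists (rev s); rewrite invmx_wordmx.
  apply: (smallest_sub words_subgroup) => _ [i _ <-].
  by exists [:: i]; rewrite /= mulmx1.
move=> G [[_ G1 GM _] Gbeta]; elim: s => [|i s IHs] /=; first exact: G1.
by apply: GM => //; apply: Gbeta; exists i.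
Qed.

Lemma Gamma_subgroup : is_subgroup Gamma.
Proof.
split=> [T||T M|T].
- by move=> /GammaP[s ->]; have /mulmx1_unit[] := wordmx_rev s.
- by apply/GammaP; exists [::].
- by move=> /GammaP[s ->] /GammaP[t ->]; apply/GammaP; exists (s ++ t); rewrite wordmx_cat.
- by move=> /GammaP[s ->]; apply/GammaP; exists (rev s); rewrite invmx_wordmx.
Qed.

Definition nu_orb : set 'rV[R]_10 := group_orbit Gamma [set nu].

Lemma nu_orbP x : nu_orb x <-> exists s, x = nu *m wordmx s.
Proof.
split=> [[_ -> [T /GammaP[s ->] <-]]|[s ->]]; first by exists s.
by exists nu => //; exists (wordmx s) => //; apply/GammaP; exists s.
Qed.

Lemma nu_orb_packing : is_packing A 2 nu_orb.
Proof.
split=> [_ /nu_orbP[s ->]|_ _ /nu_orbP[s ->] /nu_orbP[t ->]].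
  by rewrite ldot_wordmx nu_nu.
have -> : nu *m wordmx t = nu *m wordmx (t ++ rev s) *m wordmx s.
  by rewrite -mulmxA wordmx_cat -(mulmxA (wordmx t)) wordmx_rev mulmx1.
rewrite ldot_wordmx; case: (nu_orbit (t ++ rev s)) => // -> /(_ erefl).
by case.
Qed.

(** Coordinates are functions on [nat] with integer values so that products of such vectors can be
    computed. *)
Definition zvec (c : nat -> int) : 'rV[R]_10 := \sum_(k < 10) (c k)%:~R *: b k.

Lemma zvec_beta c j : zvec c *d b j = (\sum_(k < 10) c k * gram k j)%:~R.
Proof.
rewrite ldot_suml; under eq_bigr do rewrite ldotZl beta_gram -intrM.
by rewrite -[LHS](raddf_sum (intmul 1)).
Qed.

Lemma zvec_zvec c d : zvec c *d zvec d =
  (\sum_(l < 10) d l * \sum_(k < 10) c k * gram k l)%:~R.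
Proof.
rewrite ldot_sumr; under eq_bigr do rewrite ldotZr zvec_beta -intrM.
by rewrite -[LHS](raddf_sum (intmul 1)).
Qed.

(* Coordinates of [nu] after the reflections in [beta_9, ..., beta_(10-m)]. *)
Definition simplex_coef (m i : nat) : int :=
  wt_coef 9 i + if (10 - m <= i)%N then 2 else 0.

Lemma big_ord_foldr (n : nat) (F : nat -> int) :
  \sum_(k < n) F k = foldr (fun m z => F m + z) 0 (iota 0 n).
Proof. by rewrite -(big_mkord xpredT F) unlock /index_iota subn0. Qed.

Lemma simplex_zvec_zvec (m l : 'I_10) : m != l ->
  zvec (simplex_coef m) *d zvec (simplex_coef l) = 2.
Proof.
rewrite -val_eqE zvec_zvec => ml; rewrite -[RHS]/(2%:~R); congr (_%:~R).
pose G (m k : nat) :=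
  foldr (fun (j : nat) z => simplex_coef m j * gram j k + z) 0 (iota 0 10).
pose F (m l : nat) := foldr (fun (k : nat) z => simplex_coef l k * G m k + z) 0 (iota 0 10).
have FE : \sum_(k < 10) simplex_coef l k * G m k = F m l.
  exact: (big_ord_foldr 10 (fun k : nat => simplex_coef l k * G m k)).
transitivity (F m l).
  rewrite -FE; apply: eq_bigr => k _; congr (_ * _).
  exact: (big_ord_foldr 10 (fun j : nat => simplex_coef m j * gram j k)).
apply/eqP; apply: (implyP _ ml); move: m l {ml FE}.
apply: (all_ord2 10 (fun m l => (m != l) ==> (F m l == 2))).
by vm_compute.
Qed.

Lemma simplex_zvec0 : zvec (simplex_coef 0) = nu.
Proof.
rewrite nuE; apply: eq_bigr => k _.
by rewrite /simplex_coef subn0 leqNgt ltn_ord addr0.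
Qed.

(** The current vector has product 2 with the next root, so the reflection adds 2 to that single
    coordinate. *)
Lemma simplex_zvecS (m : 'I_9) :
  zvec (simplex_coef m.+1) = zvec (simplex_coef m) *m rmx (inord (9 - m)).
Proof.
have pair2 : zvec (simplex_coef m) *d b (inord (9 - m)) = 2.
  rewrite zvec_beta inordK ?ltnS ?leq_subr // -[RHS]/(2%:~R); congr (_%:~R).
  rewrite (big_ord_foldr 10 (fun k : nat => simplex_coef m k * gram k (9 - m))).
  pose F (m : nat) := foldr (fun (k : nat) z => simplex_coef m k * gram k (9 - m) + z) 0 (iota 0 10).
  apply/eqP; apply: (all_ord2 9 (fun m _ => F m == 2) _ m m).
  by vm_compute.
rewrite mul_rmx pair2 /zvec (bigD1 (inord (9 - m))) //=.
rewrite [in RHS](bigD1 (inord (9 - m))) //= addrAC -scalerDl; congr (_ + _).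
  rewrite /simplex_coef inordK ?ltnS ?leq_subr // subSS leqnn; congr (_ *: _).
  rewrite (_ : (10 - m <= 9 - m)%N = false); last by have := ltn_ord m; lia.
  by rewrite addr0 intrD.
apply: eq_bigr => k km; congr ((_ + _)%:~R *: _); congr (if _ then _ else _).
move: km; rewrite -val_eqE /= inordK ?ltnS ?leq_subr // subSS.
by have := ltn_ord m; have := ltn_ord k; lia.
Qed.

Lemma simplex_zvec_orb (m : 'I_10) : nu_orb (zvec (simplex_coef m)).
Proof.
case: m => m /=; elim: m => [|m IHm] m10.
  by rewrite simplex_zvec0; apply/nu_orbP; exists [::]; rewrite mulmx1.
have /nu_orbP[s sE] := IHm (ltnW m10).
rewrite (simplex_zvecS (Ordinal (m10 : (m < 9)%N))) /= sE.
by apply/nu_orbP; exists (rcons s (inord (9 - m))); rewrite -cats1 wordmx_cat /= mulmx1 mulmxA.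
Qed.

Lemma nu_orb_apollonian : apollonian_property A 2 nu_orb.
Proof.
move=> _ /nu_orbP[s ->].
exists (fun m : 'I_10 => zvec (simplex_coef m) *m wordmx s).
have dot2 (i j : 'I_10) : i != j ->
    zvec (simplex_coef i) *m wordmx s *d (zvec (simplex_coef j) *m wordmx s) = 2.
  by move=> ij; rewrite ldot_wordmx simplex_zvec_zvec.
split=> [m||i j ij].
- have /nu_orbP[t ->] := simplex_zvec_orb m.
  by apply/nu_orbP; exists (t ++ s); rewrite wordmx_cat mulmxA.
- by exists ord0; rewrite simplex_zvec0.
split; last exact: dot2.
move=> ijE; have := dot2 _ _ ij; rewrite ijE ldot_wordmx.
have /nu_orbP[t ->] := simplex_zvec_orb j.
by rewrite ldot_wordmx nu_nu => /eqP; rewrite eqNr pnatr_eq0.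
Qed.

(** * The fundamental chamber *)

Definition root_lattice : set 'rV[R]_10 :=
  [set x | exists c : 'I_10 -> int, x = \sum_(i < 10) tnth beta i *~ c i].

Lemma root_latticeP x :
  root_lattice x <-> exists c : 'I_10 -> int, x = \sum_i (c i)%:~R *: b i.
Proof.
by split=> -[c ->]; exists c; apply: eq_bigr => i _; rewrite scaler_int.
Qed.

Lemma root_lattice_beta i : root_lattice (b i).
Proof.
exists (fun k => (k == i)%:Z); rewrite (bigD1 i) //= eqxx mulr1z big1 ?addr0 //.
by move=> k /negPf ->; rewrite mulr0z.
Qed.

Lemma root_latticeD x y : root_lattice x -> root_lattice y -> root_lattice (x + y).
Proof.
move=> [c ->] [d ->]; exists (fun i => c i + d i); rewrite -big_split /=.
by apply: eq_bigr => i _; rewrite mulrzDr.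
Qed.

Lemma root_latticeZ (a : int) x : root_lattice x -> root_lattice (a%:~R *: x).
Proof.
move=> [c ->]; exists (fun i => c i * a); rewrite scaler_sumr.
by apply: eq_bigr => i _; rewrite scaler_int mulrzA.
Qed.

Lemma root_lattice_wt i : root_lattice (wt i).
Proof. by apply/root_latticeP; exists (fun k => wt_coef i k). Qed.

Lemma root_lattice_ldot x y : root_lattice x -> root_lattice y ->
  exists a : int, x *d y = a%:~R.
Proof.
move=> /root_latticeP[c ->] /root_latticeP[d ->].
exists (\sum_(j < 10) \sum_(i < 10) c i * d j * gram i j).
rewrite ldot_sumr [RHS](raddf_sum (intmul 1)); apply: eq_bigr => j _.
rewrite ldot_suml [RHS](raddf_sum (intmul 1)); apply: eq_bigr => i _.
by rewrite !ldot_lin beta_gram /= !intrM; ring.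
Qed.

Lemma root_lattice_wordmx x s : root_lattice x -> root_lattice (x *m wordmx s).
Proof.
elim: s x => [|i s IHs] x lx /=; first by rewrite mulmx1.
rewrite mulmxA; apply: IHs; rewrite mul_rmx.
have [a ->] := root_lattice_ldot _ _ lx (root_lattice_beta i).
by apply: root_latticeD => //; apply: root_latticeZ; exact: root_lattice_beta.
Qed.

(** A reflection cannot swap the two sheets: the product of [w0] with its image is [w0 *d w0] plus a
    square, hence positive. *)
Lemma forward_wordmx x s : x != 0 -> 0 <= x *d x -> 0 < x *d w0 ->
  0 < (x *m wordmx s) *d w0.
Proof.
elim: s x => [|i s IHs] x x0 xx xw /=; first by rewrite mulmx1.
rewrite mulmxA; apply: IHs; rewrite ?ldot_rmx //.
  by apply: contraNneq x0 => xi0; rewrite -[x]mulmx1 -(rmxK i) mulmxA xi0 mul0mx.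
rewrite -[w0]mulmx1 -(rmxK i) mulmxA ldot_rmx dotC.
apply: (ldot_causal_gt0 A lorA w0); rewrite ?ldot_rmx ?w0_w0_gt0 //; last exact: ltW.
rewrite mul_rmx !ldot_lin (dotC (b i)) -expr2.
by apply: ltr_wpDr; [exact: sqr_ge0|exact: w0_w0_gt0].
Qed.

Lemma sheet_neq0 x : sheet A w0 x -> x != 0.
Proof.
by move=> [xx _]; apply/eqP => x0; move/eqP: xx; rewrite x0 ldot0l eq_sym oner_eq0.
Qed.

Lemma sheet_wordmx x s : sheet A w0 x -> sheet A w0 (x *m wordmx s).
Proof.
move=> xS; have [xx xw] := xS; split; first by rewrite ldot_wordmx.
by apply: forward_wordmx => //; [exact: sheet_neq0|rewrite xx].
Qed.

Lemma wordmxKV s x : x *m wordmx (rev s) *m wordmx s = x.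
Proof. by rewrite -mulmxA wordmx_rev mulmx1. Qed.

Lemma wordmxK s x : x *m wordmx s *m wordmx (rev s) = x.
Proof. by rewrite -{1}(revK s) wordmxKV. Qed.

Lemma image_wordmx (X : set 'rV[R]_10) s :
  (forall x t, X x -> X (x *m wordmx t)) -> mulmxr (wordmx s) @` X = X.
Proof.
move=> stable; apply/seteqP; split=> [_ [x Xx <-]|x Xx]; first exact: stable.
by exists (x *m wordmx (rev s)); [exact: stable|exact: wordmxKV].
Qed.

Lemma Gamma_Oplus : Gamma `<=` Oplus_lattice A w0 root_lattice.
Proof.
move=> _ /GammaP[s ->]; split; last first.
  by apply: image_wordmx => x t; exact: root_lattice_wordmx.
split; first by move=> x y; exact: ldot_wordmx.
by apply: image_wordmx => x t; exact: sheet_wordmx.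
Qed.

(** Twice the Weyl vector: a lattice vector that is timelike and strictly dominant. *)
Definition rho := \sum_i wt i.

Lemma rho_beta i : rho *d b i = 2.
Proof.
rewrite ldot_suml (bigD1 i) //= wt_beta eqxx big1 ?addr0 // => k ki.
by rewrite wt_beta (negPf ki).
Qed.

Lemma rho_wt_gt0 i : 0 < rho *d wt i.
Proof.
rewrite ldot_suml; under eq_bigr => k _ do rewrite wt_wt.
rewrite -mulr_sumr pmulr_rgt0 //.
pose F (i : nat) := foldr (fun (k : nat) z => wt_coef k i + z) 0 (iota 0 10).
have F0 : all (fun p => all (fun=> 0 < F p) (iota 0 10)) (iota 0 10) by vm_compute.
have := all_ord2 10 _ F0 i i; rewrite -(ltr0z R).
have -> // : F i = \sum_(k < 10) wt_coef k i.
  exact: esym (big_ord_foldr 10 (fun k : nat => wt_coef k i)).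
by rewrite [X in 0 < X -> _](raddf_sum (intmul 1)).
Qed.

Lemma cone_rho : cone rho.
Proof. by move=> i; exact/ltW/rho_wt_gt0. Qed.

Lemma rho_rho_gt0 : 0 < rho *d rho.
Proof.
rewrite {2}/rho ldot_sumr (bigD1 ord0) //=; apply: ltr_wpDr; last exact: rho_wt_gt0.
by apply: sumr_ge0 => i _; exact/ltW/rho_wt_gt0.
Qed.

Lemma rho_neq0 : rho != 0.
Proof. by apply: contraTneq rho_rho_gt0 => ->; rewrite ldot0l ltxx. Qed.

Lemma rho_w0_gt0 : 0 < rho *d w0.
Proof. by rewrite w0E ldotZr pmulr_rgt0 ?invr_gt0 // rho_wt_gt0. Qed.

Lemma root_lattice_rho : root_lattice rho.
Proof.
rewrite /rho; elim/big_ind: _ => [||i _]; [|exact: root_latticeD|exact: root_lattice_wt].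
by exists (fun=> 0); rewrite big1.
Qed.

Lemma dominant_rho : dominant rho.
Proof. by move=> i; rewrite rho_beta. Qed.

Lemma cone_rho_wordmx s : cone (rho *m wordmx s).
Proof.
have [t redt <-] := reduced_exists s.
rewrite -[_ *m _](subrK rho); apply: coneD; last exact: cone_rho.
by apply: dominant_cone_sub => //; exact: dominant_rho.
Qed.

(* [x - e rho] is still timelike for small [e], so that bounding [x . y] *)
(* bounds [rho . y] over the forward timelike vectors [y].               *)
Lemma sheet_bound_rho x : sheet A w0 x -> exists2 e : R, 0 < e &
  forall s, e * (rho *d (rho *m wordmx s)) <= x *d (rho *m wordmx s).
Proof.
move=> [xx xw].
have [e e0 [ee ew]] : exists2 e : R, 0 < e &
    0 < (x - e *: rho) *d (x - e *: rho) /\ 0 < (x - e *: rho) *d w0.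
  pose d := 1 + 2 * `|x *d rho|; pose a := rho *d w0.
  have rw : 0 < a by exact: rho_w0_gt0.
  have d0 : 0 < d by rewrite /d ltr_pwDl // mulr_ge0.
  (* The first bound keeps the square of [x - e *: rho] positive, the second its product with
     [w0]. *)
  exists (Num.min d^-1 ((x *d w0) / (2 * a))).
    by rewrite lt_min invr_gt0 d0 divr_gt0 // mulr_gt0.
  set e := Num.min _ _.
  have ed : e * d <= 1 by rewrite -ler_pdivlMr // mul1r ge_min lexx.
  have ea : e * (2 * a) <= x *d w0.
    by rewrite -ler_pdivlMr ?mulr_gt0 // ge_min lexx orbT.
  have e0 : 0 < e by rewrite lt_min invr_gt0 d0 divr_gt0 // mulr_gt0.
  rewrite !ldot_lin (dotC rho x) xx -/a; split; last by nra.
  have := rho_rho_gt0; have := ler_norm (x *d rho); rewrite /d in ed; nra.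
exists e => // s; rewrite -subr_ge0 -ldotZl -ldotNl -ldotDl ltW //.
apply: (ldot_causal_gt0 A lorA w0); rewrite ?ldot_wordmx ?w0_w0_gt0 //.
- exact/ltW/rho_rho_gt0.
- by apply: contraNneq rho_neq0 => r0; rewrite -(wordmxK s rho) r0 mul0mx.
- apply/ltW/forward_wordmx; [exact: rho_neq0|exact/ltW/rho_rho_gt0|exact: rho_w0_gt0].
Qed.

(** Orbit vectors [y] of [rho] with [x *d y <= x *d rho] have nonnegative integer coordinates,
    bounded by [sheet_bound_rho]. They fit in a finite box, so a minimiser of [x *d y] exists. *)
Lemma sheet_dominant x : sheet A w0 x -> exists s, dominant (x *m wordmx s).
Proof.
move=> xS; have [e e0 xrho] := sheet_bound_rho _ xS.
pose C := x *d rho / e.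
pose N := (Num.truncn C).+1.
pose vec (m : {ffun 'I_10 -> 'I_N}) := \sum_i (m i)%:R *: b i : 'rV[R]_10.
have box s : x *d (rho *m wordmx s) <= x *d rho -> exists m, vec m = rho *m wordmx s.
  move=> xs; set y := rho *m wordmx s in xs *.
  have /root_latticeP[c yE] : root_lattice y.
    by apply: root_lattice_wordmx; exact: root_lattice_rho.
  have cE i : (c i)%:~R = y *d wt i / 2 by rewrite yE sum_beta_wt mulrC mulKf.
  have c_ge0 i : 0 <= c i.
    by rewrite -(ler0z R) cE divr_ge0 //; exact: cone_rho_wordmx.
  have rhoy : rho *d y <= C.
    by rewrite ler_pdivlMr // mulrC; apply: le_trans (xrho s) _.
  have cN i : (`|c i| < N)%N.
    rewrite ltnS truncn_ge_nat; last first.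
      rewrite (le_trans _ rhoy) // dotC /rho ldot_sumr.
      by apply: sumr_ge0 => k _; exact: cone_rho_wordmx.
    apply: le_trans rhoy; rewrite pmulrn gez0_abs // cE (dotC rho).
    rewrite /rho ldot_sumr (bigD1 i) //= ler_wpDr //.
      by apply: sumr_ge0 => k _; exact: cone_rho_wordmx.
    by rewrite ler_pdivrMr // ler_peMr ?ler1n //; exact: cone_rho_wordmx.
  exists [ffun i => Ordinal (cN i)]; rewrite yE; apply: eq_bigr => i _.
  by rewrite ffunE /= -[in RHS](gez0_abs (c_ge0 i)).
have xrho1 : x *d (rho *m wordmx [::]) <= x *d rho by rewrite mulmx1.
have [m0 m0E] := box [::] xrho1.
pose P m := `[< exists s, vec m = rho *m wordmx s >].
have Pm0 : P m0 by apply/asboolP; exists [::].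
case: (@arg_minP _ _ _ m0 P (fun m => x *d vec m) Pm0) => m /asboolP[s mE] m_min.
exists (rev s) => i; rewrite leNgt; apply/negP => neg.
(* Inserting [i] in front of the minimising word changes the product by twice the negative number
   [neg]. *)
have lt : x *d (rho *m wordmx (i :: s)) < x *d vec m.
  rewrite mE /= mulmxA mul_rmx rho_beta mulmxDl -scalemxAl !ldot_lin.
  by move: neg; rewrite -(ldot_wordmx s) wordmxKV; lra.
have m_rho : x *d vec m <= x *d rho.
  by apply: le_trans (m_min _ Pm0) _; rewrite m0E mulmx1.
have [m' m'E] := box _ (le_trans (ltW lt) m_rho).
have Pm' : P m' by apply/asboolP; exists (i :: s).
by have := m_min _ Pm'; rewrite m'E leNgt lt.
Qed.

(** Phrased with membership in [beta] to match [finite_sided_polyhedron]. *)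
Definition chamber : set 'rV[R]_10 :=
  [set x | sheet A w0 x /\ forall v, v \in tval beta -> 0 <= v *d x].

Lemma chamberP x : chamber x <-> sheet A w0 x /\ dominant x.
Proof.
split=> -[xS xd]; split=> //.
  by move=> i; rewrite dotC; apply: xd; exact: mem_tnth.
by move=> _ /tnthP[i ->]; rewrite dotC.
Qed.

(** If [x] were on the wall of the root [v], the curve [p t] through [x] would stay on the sheet,
    since [v *d v = -2], yet leave the translate at once, as [p t *d v = -2 * t]. *)
Lemma sheet_interior_chamber s x i :
  sheet_interior A w0 (mulmxr (wordmx s) @` chamber) x ->
  0 < (x *m wordmx (rev s)) *d b i.
Proof.
move=> [xS xnear]; have [xx xw] := xS.
have img_ge0 z : (mulmxr (wordmx s) @` chamber) z -> 0 <= z *d (b i *m wordmx s).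
  by move=> [y /chamberP[_ yd] <-]; rewrite ldot_wordmx.
set v := b i *m wordmx s in img_ge0.
have xv : (x *m wordmx (rev s)) *d b i = x *d v by rewrite -(ldot_wordmx s) wordmxKV.
have vv : v *d v = -2 by rewrite ldot_wordmx beta_diag.
rewrite xv lt_def img_ge0 ?andbT; last exact: (nbhs_singleton xnear).
apply/eqP => xv0.
pose p (t : R) := Num.sqrt (1 + 2 * t ^+ 2) *: x + t *: v.
have p0 : p 0 = x by rewrite /p expr0n mulr0 addr0 sqrtr1 scale1r scale0r addr0.
have p_cvg : p t @[t --> (0 : R)^'+] --> x.
  rewrite -[X in _ --> X]p0; apply: cvg_at_right_filter.
  apply: cvgD; (apply: cvgZ; last exact: cvg_cst); last exact: cvg_id.
  apply: continuous_cvg; first exact: sqrt_continuous.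
  apply: cvgD; first exact: cvg_cst.
  apply: cvgMl_tmp; apply: exprn_continuous.
have pw : \forall t \near (0 : R)^'+, 0 < p t *d w0.
  have : p t *d w0 @[t --> (0 : R)^'+] --> x *d w0 by apply: cvg_ldot => //; exact: cvg_cst.
  by move/cvgr_gt; apply.
have pin : \forall t \near (0 : R)^'+, sheet A w0 (p t) -> (mulmxr (wordmx s) @` chamber) (p t).
  exact: p_cvg xnear.
near (0 : R)^'+ => t.
have t0 : 0 < t by near: t; exact: nbhs_right_gt.
have pt : sheet A w0 (p t).
  split; last by near: t.
  rewrite /p !ldot_lin xx vv (dotC v x) xv0 !mulr0 !addr0 add0r mulr1 -expr2.
  by rewrite sqr_sqrtr; [ring|rewrite addr_ge0 // mulr_ge0 // sqr_ge0].
have : (mulmxr (wordmx s) @` chamber) (p t) by move: pt; near: t.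
move/img_ge0; rewrite /p !ldot_lin xv0 vv mulr0 add0r; lra.
Unshelve. all: by end_near.
Qed.

(** If a nonempty reduced word fixes [x], its first letter contributes a positive multiple of a
    positive root that the other letters must cancel. That root and its opposite are then in the
    cone, so it is zero, against its square -2. *)
Lemma strictly_dominant_fixed s x : (forall i, 0 < x *d b i) ->
  x *m wordmx s = x -> wordmx s = 1%:M.
Proof.
move=> xd; have [t redt <-] := reduced_exists s.
case: t redt => [//|i t] red /= fix_x.
have dx : dominant x by move=> j; exact: ltW.
have ci := cone_beta_reduced _ _ red.
have : b i *m wordmx t = 0.
  apply: cone_anti => // j; rewrite -(pmulr_rge0 _ (xd i)) -ldotZl.
  have := dominant_cone_sub _ _ (reduced_cons _ _ red) dx j.
  rewrite -[X in _ - X]fix_x mulmxA mul_rmx mulmxDl -scalemxAl opprD addrA subrr sub0r.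
  by rewrite scalerN.
move=> bi0; have := ldot_wordmx t (b i) (b i).
by rewrite bi0 ldot0l beta_diag => /eqP; rewrite eq_sym oppr_eq0 pnatr_eq0.
Qed.

Lemma chamber_fundamental : fundamental_domain A w0 Gamma chamber.
Proof.
split=> [x []//||].
  apply/seteqP; split=> [x [_ /GammaP[s ->] [y [yS _] <-]]|x xS].
    exact: sheet_wordmx.
  have [s xs] := sheet_dominant _ xS.
  exists (wordmx (rev s)); first by apply/GammaP; exists (rev s).
  exists (x *m wordmx s); last exact: wordmxK.
  by apply/chamberP; split=> //; exact: sheet_wordmx.
move=> _ _ /GammaP[s ->] /GammaP[t ->] st; apply/seteqP; split=> // x [xs xt].
(* A common interior point gives two strictly dominant vectors in one orbit. They coincide, and
   their stabiliser is trivial. *)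
have xsd i := sheet_interior_chamber _ _ i xs.
have xtd i := sheet_interior_chamber _ _ i xt.
case/eqP: st; set y := x *m wordmx (rev s) in xsd.
have yE : y *m wordmx (s ++ rev t) = x *m wordmx (rev t).
  by rewrite wordmx_cat mulmxA wordmxKV.
have yfix : y *m wordmx (s ++ rev t) = y.
  by apply: dominant_unique => i; [|rewrite yE]; exact: ltW.
have := strictly_dominant_fixed _ _ xsd yfix; rewrite wordmx_cat => st1.
by rewrite -[LHS]mulmx1 -(wordmx_rev t) mulmxA st1 mul1mx.
Qed.

Lemma nu_orb_crystallographic : crystallographic A w0 nu_orb.
Proof.
exists root_lattice, Gamma, [set nu]; split=> //.
- by exists beta.
- by split; [exact: Gamma_subgroup|exact: Gamma_Oplus].
- exists chamber; last exact: chamber_fundamental.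
  by exists beta => // _ /tnthP[i ->]; rewrite beta_diag oppr_lt0.
- by split=> [|_ ->]; [exact: finite_set1|rewrite nuE; exact: root_lattice_wt].
Qed.

(** * Maximality *)

Lemma intr_le_N1 (a : int) : a%:~R < 0 :> R -> a%:~R <= -1 :> R.
Proof. by rewrite ltrz0 (_ : -1 = (-1)%:~R) // ler_int; lia. Qed.

(** By integrality, reflecting in a simple root with negative product lowers [rho *d e] by at least
    2, while that product stays positive. *)
Lemma root_lattice_dominant e : root_lattice e -> e != 0 -> 0 <= e *d e ->
  0 < e *d w0 -> exists s, dominant (e *m wordmx s).
Proof.
suff descent n : forall e, root_lattice e -> e != 0 -> 0 <= e *d e ->
    0 < e *d w0 -> rho *d e <= n%:R -> exists s, dominant (e *m wordmx s).
  move=> le e0 ee ew; apply: (descent (Num.truncn (rho *d e)).+1) => //.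
  exact/ltW/truncnS_gt.
elim: n => [|n IHn] {}e le e0 ee ew en.
  have := ldot_causal_gt0 A lorA w0 rho e rho_rho_gt0 ee e0 w0_w0_gt0 rho_w0_gt0 (ltW ew).
  by rewrite ltNge en.
have [de|] := pselect (dominant e); first by exists [::]; rewrite mulmx1.
move=> /existsNP[i /negP]; rewrite -ltNge => ei.
have [a aE] := root_lattice_ldot _ _ le (root_lattice_beta i).
have [] := IHn (e *m rmx i).
- by have := root_lattice_wordmx _ [:: i] le; rewrite /= mulmx1.
- by apply: contraNneq e0 => ei0; rewrite -[e]mulmx1 -(rmxK i) mulmxA ei0 mul0mx.
- by rewrite ldot_rmx.
- by have := forward_wordmx _ [:: i] e0 ee ew; rewrite /= mulmx1.
- rewrite mul_rmx !ldot_lin rho_beta.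
  have : e *d b i <= -1 by rewrite aE; apply: intr_le_N1; rewrite -aE.
  by move: en; rewrite -natr1; lra.
by move=> s ds; exists (i :: s); rewrite /= mulmxA.
Qed.

(* The only isotropic rays of the polytope cut out of the chamber by [nu] are *)
(* spanned by [wt 1] and by [wt 8], and the latter is orthogonal to [nu].     *)
Lemma isotropic_dominant c : dominant c -> c *d c = 0 -> 0 < c *d nu ->
  c = (c *d b (node 1) / 2) *: wt (node 1).
Proof.
move=> dc cc cnu.
have c_wt i : c *d wt i = \sum_j c *d b j * (wt_coef j i)%:~R.
  rewrite {1}(wt_expand c) ldot_suml; apply: eq_bigr => j _.
  by rewrite ldotZl wt_wt mulrA divfK.
have term_ge0 i j : i != node 9 -> 0 <= c *d b j * (wt_coef j i)%:~R.
  by move=> i9; rewrite mulr_ge0 ?dc // ler0z wt_coefC; apply: wt_coef_ge0.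
(* Row 9, the only one with a negative entry, is covered by the hypothesis on [nu]. *)
have cwt_ge0 i : 0 <= c *d wt i.
  have [->|i9] := eqVneq i (node 9); first by rewrite -nuE ltW.
  by rewrite c_wt; apply: sumr_ge0 => j _; exact: term_ge0.
have prod0 i : c *d b i * (c *d wt i) = 0.
  have : \sum_i c *d b i / 2 * (c *d wt i) = 0.
    transitivity (c *d \sum_j (c *d b j / 2) *: wt j); last by rewrite -wt_expand.
    by rewrite ldot_sumr; apply: eq_bigr => j _; rewrite ldotZr.
  move/eqP; rewrite psumr_eq0 => [/allP/(_ i (mem_index_enum _))/eqP|j _].
    by rewrite mulrAC => /eqP; rewrite mulf_eq0 invr_eq0 pnatr_eq0 orbF => /eqP.
  by rewrite mulr_ge0 // divr_ge0.
have pair0 i j : i != node 9 -> c *d b i * (c *d b j * (wt_coef j i)%:~R) <= 0.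
  move=> i9; rewrite -(prod0 i) ler_wpM2l // c_wt (bigD1 j) //= lerDl.
  by apply: sumr_ge0 => k _; exact: term_ge0.
have c9 : c *d b (node 9) = 0.
  by have /eqP := prod0 (node 9); rewrite -nuE mulf_eq0 (gt_eqF cnu) orbF => /eqP.
have c_diag i : (i : nat) \notin [:: 1; 8; 9]%N -> c *d b i = 0.
  move=> i189; have i9 : i != node 9.
    by apply: contraNneq i189 => ->.
  have := pair0 i i i9; have := wt_coef_diag_gt0 _ i189.
  rewrite -(ltr0z R) mulrA -expr2 => wt_gt0; rewrite pmulr_lle0 // => sq.
  by apply/eqP; rewrite -sqrf_eq0 eq_le sq sqr_ge0.
have c189 i : i != node 1 -> i != node 8 -> c *d b i = 0.
  move=> i1 i8; have [->//|i9] := eqVneq i (node 9).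
  by apply: c_diag; rewrite !inE; rewrite -!val_eqE in i1 i8 i9; rewrite !negb_or; apply/and3P.
(* Only nodes 1 and 8 remain, and [wt 8] is orthogonal to [nu]. *)
have c1 : 0 < c *d b (node 1).
  move: cnu; rewrite nuE c_wt (bigD1 (node 1)) //= (bigD1 (node 8)) //= big1 => [|j /andP[j1 j8]].
    by rewrite mulr1 mulr0 !addr0.
  by rewrite c189 ?mul0r.
(* The table entry between nodes 1 and 8 is positive, so both coordinates cannot be positive. *)
have c8 : c *d b (node 8) = 0.
  have := pair0 (node 1) (node 8) isT; rewrite pmulr_rle0 // pmulr_lle0 ?ltr0z // => c8.
  by apply/eqP; rewrite eq_le c8 dc.
rewrite {1}(wt_expand c) (bigD1 (node 1)) //= big1 ?addr0 // => j j1.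
have [->|j8] := eqVneq j (node 8); first by rewrite c8 mul0r scale0r.
by rewrite c189 // mul0r scale0r.
Qed.

(** Since [wt 1] has [b 9]-coordinate 1, a lattice vector on its ray is an integer multiple of it;
    and [wt 1] has even products with the lattice. *)
Lemma isotropic_dominant_even c y : root_lattice c -> dominant c -> c *d c = 0 ->
  0 < c *d nu -> root_lattice y -> exists a : int, c *d y = (2 * a)%:~R.
Proof.
move=> /root_latticeP[m mE] dc cc cnu /root_latticeP[d ->].
have cE := isotropic_dominant _ dc cc cnu.
have m9 : c *d b (node 1) = 2 * (m (node 9))%:~R.
  by rewrite -(sum_beta_wt (fun i => (m i)%:~R)) -mE [in RHS]cE ldotZl wt_wt mulr1 divfK.
exists (m (node 9) * d (node 1)).
rewrite cE m9 ldotZl dotC sum_beta_wt !intrM; lra.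
Qed.

(** The group preserves both the form and the lattice, so an odd product survives the passage to the
    dominant translate, where [isotropic_dominant_even] forbids it. *)
Lemma odd_isotropic_not_residual e y : root_lattice e -> e != 0 -> e *d e = 0 ->
  0 < e *d w0 -> root_lattice y -> (forall a : int, e *d y <> (2 * a)%:~R) ->
  exists2 v, nu_orb v & v *d e <= 0.
Proof.
move=> le e0 ee ew ly odd.
have [s ds] : exists s, dominant (e *m wordmx s).
  by apply: root_lattice_dominant => //; rewrite ee.
exists (nu *m wordmx (rev s)); first by apply/nu_orbP; exists (rev s).
rewrite leNgt; apply/negP => pos.
have [|||||a] := isotropic_dominant_even (e *m wordmx s) (y *m wordmx s).
- exact: root_lattice_wordmx.
- exact: ds.
- by rewrite ldot_wordmx.
- by rewrite dotC -(ldot_wordmx (rev s)) wordmxK.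
- exact: root_lattice_wordmx.
by rewrite ldot_wordmx; exact: odd.
Qed.

(* Locked, so that rewriting with [ldot_lin] does not see through it. *)
Definition cusp : 'rV[R]_10 := locked (2^-1 *: wt (node 8)).

Lemma cusp_wt : cusp = 2^-1 *: wt (node 8).
Proof. by rewrite /cusp -lock. Qed.

(** Shows that the half of [wt 8] is still a lattice vector. *)
Lemma cuspE : cusp = nu + b (node 9).
Proof.
apply: beta_separates => i; rewrite cusp_wt ldotZl wt_beta ldotDl nu_beta beta_gram.
rewrite -val_eqE /=; apply/eqP; case: i => m m10 /=.
do 10?[case: m m10 => [|m] m10; first by rewrite /gram /=; apply/eqP; lra].
by [].
Qed.

Lemma root_lattice_cusp : root_lattice cusp.
Proof.
rewrite cuspE nuE; apply: root_latticeD; first exact: root_lattice_wt.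
exact: root_lattice_beta.
Qed.

Lemma cusp_cusp : cusp *d cusp = 0.
Proof. by rewrite cusp_wt !ldot_lin wt_wt !mulr0. Qed.

Lemma cusp_nu : cusp *d nu = 0.
Proof. by rewrite cusp_wt nuE ldotZl wt_wt !mulr0. Qed.

Lemma sum_beta_cusp (c : 'I_10 -> R) : (\sum_k c k *: b k) *d cusp = c (node 8).
Proof. by rewrite cusp_wt ldotZr sum_beta_wt mulKf. Qed.

Lemma cusp_w0_gt0 : 0 < cusp *d w0.
Proof. by rewrite cusp_wt w0E !ldot_lin wt_wt !pmulr_rgt0 ?invr_gt0 // ltr0z. Qed.

(** Two forward null vectors have positive product unless proportional, and [x] is not proportional
    to [cusp] because [cusp *d nu = 0]. *)
Lemma ldot_cusp_gt0 x : x *d x = 0 -> 0 < x *d w0 -> 0 < x *d nu -> 0 < x *d cusp.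
Proof.
move=> xx xw xnu; pose a := x *d w0 / (cusp *d w0).
have a0 : 0 < a by rewrite divr_gt0 // cusp_w0_gt0.
pose z := x - a *: cusp.
have wz : w0 *d z = 0.
  by rewrite !ldot_lin !(dotC w0) /a divfK ?subrr // gt_eqF // cusp_w0_gt0.
have zz : z *d z = - (2 * a * (x *d cusp)).
  by rewrite !ldot_lin xx cusp_cusp (dotC cusp x); ring.
have [zz_le0 z0] := ldot_orthogonal_le0 A lorA _ _ w0_w0_gt0 wz.
rewrite lt_def; apply/andP; split; last by rewrite zz in zz_le0; nra.
apply/eqP => xcusp; have /subr0_eq xE : z = 0 by apply: z0; rewrite zz xcusp mulr0 oppr0.
by move: xnu; rewrite xE ldotZl cusp_nu mulr0 ltxx.
Qed.

(** Evenness makes the coefficient [v *d v / 2] in [odd_isotropic_dense] an integer. *)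
Lemma root_lattice_even x : root_lattice x -> exists a : int, x *d x = (2 * a)%:~R.
Proof.
move=> /root_latticeP[c ->].
suff : root_lattice (\sum_i (c i)%:~R *: b i) /\
    exists a : int, (\sum_i (c i)%:~R *: b i) *d (\sum_i (c i)%:~R *: b i) = (2 * a)%:~R.
  by case.
elim/big_ind: _ => [|x1 x2 [l1 [a1 E1]] [l2 [a2 E2]]|i _].
- by split; [exists (fun=> 0); rewrite big1|exists 0; rewrite ldot0l].
- split; first exact: root_latticeD.
  have [a aE] := root_lattice_ldot _ _ l1 l2.
  exists (a1 + a2 + a); rewrite !ldot_lin (dotC x2) E1 E2 aE.
  by rewrite !mulrDr !intrD !intrM; ring.
split; first by apply: root_latticeZ; exact: root_lattice_beta.
by exists (- (c i * c i)); rewrite !ldot_lin beta_diag intrM mulrNz intrM; ring.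
Qed.

(* [v |-> (v . f) v - (v . v / 2) f], where [f] is [cusp], maps onto the light *)
(* cone up to scaling, fixes its rays and keeps the root lattice; lattice points *)
(* with odd coordinates are dense up to scaling.                                 *)
Lemma odd_isotropic_dense x (V : set 'rV[R]_10) :
  x *d x = 0 -> 0 < x *d w0 -> 0 < x *d cusp -> nbhs x V ->
  exists e (a : R), [/\ 0 < a, V (a *: e), root_lattice e, e *d e = 0 &
    0 < e *d w0 /\ forall k : int, e *d cusp <> (2 * k)%:~R].
Proof.
move=> xx xw xf nV.
pose phi v := (x *d cusp)^-1 *: ((v *d cusp) *: v - (v *d v / 2) *: cusp).
have phix : phi x = x.
  by rewrite /phi xx mul0r scale0r subr0 scalerA mulVf ?scale1r // gt_eqF.
have phi_cvg : phi v @[v --> x] --> x.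
  suff cvg_phi (F : set_system 'rV[R]_10) : Filter F -> id v @[v --> F] --> x ->
      phi v @[v --> F] --> phi x.
    by rewrite -[X in _ --> X]phix; apply: (cvg_phi _ (nbhs_filter x)); exact: cvg_id.
  move=> FF Fx; apply: cvgZl_tmp; apply: cvgB; apply: cvgZ => //.
  - by apply: cvg_ldot => //; exact: cvg_cst.
  - by apply: cvgMr_tmp; apply: cvg_ldot.
  - exact: cvg_cst.
have cvg_w0 (F : set_system 'rV[R]_10) : Filter F -> phi v @[v --> F] --> x ->
    phi v *d w0 @[v --> F] --> x *d w0.
  by move=> FF phiF; apply: cvg_ldot => //; exact: cvg_cst.
have near_x : \forall v \near x, V (phi v) /\ 0 < phi v *d w0.
  near=> v; split; first by near: v; exact: phi_cvg nV.
  by near: v; exact: (cvgr_gt _ (cvg_w0 _ (nbhs_filter x) phi_cvg) _ xw).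
have /nbhs_normP[d /= d0 ball_d] := near_x.
have [c xE] := beta_span x.
pose K := \sum_i `|b i|.
have K0 : 0 <= K by apply: sumr_ge0.
pose N := (Num.truncn (K / d)).+1.
have NK : K < N%:R * d by rewrite -ltr_pdivrMr //; exact: truncnS_gt.
have N0 : 0 < N%:R :> R by rewrite ltr0n.
(* An odd integer within 1 of [N%:R * c i]; the choice of [N] makes the total error after rescaling
   less than [d]. *)
pose m i : int := 2 * Num.floor (N%:R * c i / 2) + 1.
pose v := \sum_i (m i)%:~R *: b i.
have m_approx i : `|c i - (m i)%:~R / N%:R| <= N%:R^-1.
  have -> : c i - (m i)%:~R / N%:R = (N%:R * c i - (m i)%:~R) / N%:R.
    by field; rewrite gt_eqF.
  rewrite normrM [`|_^-1|]ger0_norm ?invr_ge0 ?ler0n // ler_piMl ?invr_ge0 ?ler0n //.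
  have /andP[lo hi] := floor_itv (N%:R * c i / 2).
  rewrite /m intrD intrM ler_norml; move: lo hi; rewrite intrD; lra.
have v_near : `|x - N%:R^-1 *: v| < d.
  rewrite xE scaler_sumr -sumrB; apply: le_lt_trans (ler_norm_sum _ _ _) _.
  apply: (@le_lt_trans _ _ (\sum_i N%:R^-1 * `|b i|)).
    apply: ler_sum => i _; rewrite scalerA -scalerBl normrZ ler_wpM2r //.
    by rewrite [_^-1 * _]mulrC.
  by rewrite -mulr_sumr mulrC ltr_pdivrMr // mulrC.
have [Vphi phiw] := ball_d _ v_near.
have lv : root_lattice v by apply/root_latticeP; exists m.
have vf : v *d cusp = (m (node 8))%:~R by rewrite sum_beta_cusp.
have [q vv] := root_lattice_even _ lv.
pose e := (v *d cusp) *: v - (v *d v / 2) *: cusp.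
(* [phi] is quadratic, so the factor [N%:R^-1] comes out squared. *)
pose a := (x *d cusp)^-1 * N%:R^-1 ^+ 2.
have phiE : phi (N%:R^-1 *: v) = a *: e.
  rewrite /phi /e /a -[RHS]scalerA; congr (_ *: _); rewrite !ldot_lin scalerBr !scalerA.
  by congr (_ *: _ - _ *: _); ring.
have a0 : 0 < a by rewrite mulr_gt0 ?invr_gt0 ?exprn_gt0 ?invr_gt0.
exists e, a; split=> //.
- by rewrite -phiE.
- rewrite /e vf vv (_ : (2 * q)%:~R / 2 = q%:~R); last by rewrite intrM; field.
  rewrite -scaleNr -mulrNz; apply: root_latticeD; apply: root_latticeZ => //.
  exact: root_lattice_cusp.
- by rewrite /e !ldot_lin cusp_cusp (dotC cusp v); field.
split; first by move: phiw; rewrite phiE ldotZl pmulr_rgt0.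
(* As [cusp] is isotropic, [e *d cusp] is the square of the odd integer [m (node 8)]. *)
move=> k; rewrite /e !ldot_lin cusp_cusp mulr0 subr0 vf -intrM => /intr_inj.
by rewrite /m; lia.
Unshelve. all: by end_near.
Qed.

Lemma nu_orb_maximal : maximal_packing A w0 nu_orb.
Proof.
move=> U [Ub Uopen] Ures; apply/seteqP; split=> // r Ur.
have [x xL rx] := Ub _ Ur; have xr : r x by rewrite -rx; exists 1; rewrite ?scale1r /=.
have nux : 0 < x *d nu.
  have [_ rcone] := Ures _ Ur; rewrite dotC; apply: rcone => //.
  by apply/nu_orbP; exists [::]; rewrite mulmx1.
have /(light_coneP _ lorA _ _ w0_w0_gt0)[_ xx xw] := xL.
have Unear : within (light_cone A w0) (nbhs x) (\bigcup_(r in U) r).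
  by apply: Uopen; exists r.
have [e [a [a0 Ue le ee [ew odd]]]] :=
  odd_isotropic_dense _ _ xx xw (ldot_cusp_gt0 _ xx xw nux) Unear.
have e0 : e != 0 by apply: contraTneq ew => ->; rewrite ldot0l ltxx.
have [|r' Ur' r'e] := Ue.
  apply/(light_coneP _ lorA _ _ w0_w0_gt0); rewrite !ldot_lin ee !mulr0.
  by rewrite scaler_eq0 negb_or e0 gt_eqF // mulr_gt0.
have [v Pv] := odd_isotropic_not_residual _ _ le e0 ee ew root_lattice_cusp odd.
rewrite leNgt => /negP; apply; have [_ r'cone] := Ures _ Ur'.
by have := r'cone _ r'e _ Pv; rewrite ldotZr pmulr_rgt0.
Qed.

End T246.

Theorem theorem2p1 (R : realType) (A : 'M[R]_10)
    (beta : 10.-tuple 'rV[R]_10) (w0 nu : 'rV[R]_10)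
    (A_lorentzian : lorentzian A)
    (beta_basis : basis_of {:'rV[R]_10} beta)
    (beta_diag : forall i : 'I_10,
       ldot A (tnth beta i) (tnth beta i) = -2)
    (beta_offdiag : forall i j : 'I_10, i != j ->
       ldot A (tnth beta i) (tnth beta j) = if T246_adj i j then 1 else 0)
    (w0_beta : forall i : 'I_10,
       ldot A w0 (tnth beta i) = if i == 0%N :> nat then 1 else 0)
    (nu_beta : forall i : 'I_10,
       ldot A nu (tnth beta i) = if i == 9%N :> nat then 2 else 0) :
  let Gamma := generated_group [set reflection_mx A (tnth beta i) | i in [set: 'I_10]] in
  apollonian A w0 (group_orbit Gamma [set nu]).
Proof.
exists 2; first by [].
split.
- exact: nu_orb_packing.
- exact: nu_orb_crystallographic.
- exact: nu_orb_maximal.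
- exact: nu_orb_apollonian.
Qed.
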